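(* Let $R=R(S,\kappa)$ be a near-integral fusion ring. Any $\varphi\in\mathrm{Irr}(S)$ with $\varphi\neq\mathrm{FPdim}$ extends uniquely to $\tilde{\varphi}\in\mathrm{Irr}(R)$ such that $\tilde{\varphi}(\rho)=0$.
   Context: A fusion ring $(R,B)$ is a unital associative ring $R$, free as a $\mathbb{Z}$-module with finite basis $B=\{1_R=b_1,\ldots,b_n\}$, such that $b_ib_j=\sum_k c_{ij}^kb_k$ with $c_{ij}^k\in\mathbb{Z}_{\geq0}$, together with an involution $\ast$ of $\{1,\ldots,n\}$ such that $\sum_ja_jb_j\mapsto\sum_ja_jb_{j^\ast}$ is an antiautomorphism of $R$ and $c_{ij}^1=1$ if $i=j^\ast$ and $0$ otherwise. $\mathrm{FPdim}:R\to\mathbb{C}$ is the ring homomorphism sending each $b_i\in B$ to the maximal real eigenvalue of $[c_{ij}^k]_{j,k}$. A fusion subring is a fusion ring $(S,C)$ with $C\subseteq B$ and $S\subseteq R$ the $\mathbb{Z}$-span of $C$. $(R,B)$ is near-integral if it has a fusion subring $(S,C)$ with $|C|+1=|B|$. Then $\rho$ denotes the unique element of $B\setminus C$, $\kappa:=c_{\rho,\rho}^\rho\in\mathbb{Z}_{\geq0}$, and $R$ is denoted $R(S,\kappa)$; its fusion rules are those of $S$ together with $x\rho=\rho x=\mathrm{FPdim}(x)\rho$ for $x\in C$ and $\rho^2=\kappa\rho+\sum_{x\in C}\mathrm{FPdim}(x)x$. $\mathrm{Irr}(R)$ denotes the set of (isomorphism classes of) finite-dimensional complex irreducible representations $R\to\mathrm{End}(V)$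 of the fusion ring $R$ (equivalently of the semisimple algebra $R\otimes_{\mathbb{Z}}\mathbb{C}$). *)

(* Defs.v *)
From HB Require Import structures.
From mathcomp Require Import all_boot all_order all_algebra.
From mathcomp Require Import classical_sets reals.
From mathcomp Require Export complex.

Set Implicit Arguments.
Unset Strict Implicit.
Unset Printing Implicit Defensive.

Import GRing.Theory Num.Theory.

Local Open Scope ring_scope.

Definition antiautomorphism (A : nzRingType) (f : A -> A) : Prop :=
  [/\ bijective f,
      {morph f : x y / x + y},
      f 1 = 1 &
      forall x y, f (x * y) = f y * f x].

(* The basis is b_0, ..., b_n, with b_0 the unit.  The coordinate map [basis_coord]
   is determined by [basis]; its two axioms say that [basis] is a basis of A as
   a Z-module, and the structure constant c_{ij}^k is the k-th coordinate of
   b_i b_j. *)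
Record fusionRing (A : nzRingType) := FusionRing {
  corank : nat;
  basis : 'I_corank.+1 -> A;
  basis_coord : A -> 'I_corank.+1 -> int;
  dual : 'I_corank.+1 -> 'I_corank.+1;
  sum_coord : forall x, \sum_i basis i *~ basis_coord x i = x;
  coord_sum : forall a : 'I_corank.+1 -> int,
    basis_coord (\sum_i basis i *~ a i) =1 a;
  basis_unit : basis ord0 = 1;
  str_const_ge0 : forall i j k, 0 <= basis_coord (basis i * basis j) k;
  dual_involutive : involutive dual;
  dual_antiautomorphism :
    antiautomorphism (fun x => \sum_j basis (dual j) *~ basis_coord x j);
  str_const_unit : forall i j,
    basis_coord (basis i * basis j) ord0 = (i == dual j)%:Z
}.

Arguments basis {A} F i : rename.
Arguments basis_coord {A} F x i : rename.
Arguments dual {A} F i : rename.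

Definition rank (A : nzRingType) (F : fusionRing A) : nat := (corank F).+1.

Definition str_const (A : nzRingType) (F : fusionRing A)
    (i j k : 'I_(rank F)) : int :=
  basis_coord F (basis F i * basis F j) k.

Definition fusion_matrix (R : realType) (A : nzRingType) (F : fusionRing A)
    (i : 'I_(rank F)) : 'M[R]_(rank F) :=
  \matrix_(j, k) (str_const i j k)%:~R.

(* The set of real eigenvalues of a matrix is finite, so its supremum is its
   maximum as soon as it is nonempty, which Perron-Frobenius ensures for the
   nonnegative matrices [fusion_matrix]. *)
Definition max_real_eigenvalue (R : realType) (n : nat) (M : 'M[R]_n) : R :=
  sup [set a : R | eigenvalue M a]%classic.

Definition FPdim (R : realType) (A : nzRingType) (F : fusionRing A) (x : A) :
    complex R :=
  \sum_i real_complex R (max_real_eigenvalue (fusion_matrix R i)) *~ basis_coord F x i.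

(* S, a unital subring of A through \val, carries a fusion ring structure whose
   basis consists of basis elements of A.  As that basis generates S, the image
   of S in A is its Z-span. *)
Definition fusion_subring (A : nzRingType) (F : fusionRing A) (P : {pred A})
    (S : subNzRingType P) (G : fusionRing S) : Prop :=
  forall j, exists i, val (basis G j) = basis F i.

(* A = R(S, kappa), with rho the index of the basis element missing from S. *)
Definition near_integral (A : nzRingType) (F : fusionRing A) (P : {pred A})
    (S : subNzRingType P) (G : fusionRing S) (rho : 'I_(rank F))
    (kappa : nat) : Prop :=
  [/\ fusion_subring F G,
      (rank G + 1 = rank F)%N,
      forall j, val (basis G j) <> basis F rho &
      str_const rho rho rho = kappa%:Z].

Arguments near_integral {A} F {P S} G rho kappa.

Definition representation (K : fieldType) (A : nzRingType) (V : vectType K)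
    (phi : A -> 'End(V)) : Prop :=
  [/\ phi 1 = \1%VF,
      {morph phi : x y / x + y} &
      forall x y, phi (x * y) = (phi x \o phi y)%VF].

Definition irreducible_rep (K : fieldType) (A : nzRingType) (V : vectType K)
    (phi : A -> 'End(V)) : Prop :=
  [/\ representation phi,
      \dim {: V} != 0 &
      forall U : {vspace V}, (forall x, (phi x @: U <= U)%VS) ->
        U = 0%VS \/ U = fullv].

Definition rep_iso (K : fieldType) (A : nzRingType) (V W : vectType K)
    (phi : A -> 'End(V)) (psi : A -> 'End(W)) : Prop :=
  exists2 f : 'Hom(V, W), bijective f &
    forall x, (f \o phi x = psi x \o f)%VF.

Definition FPdim_rep (R : realType) (A : nzRingType) (F : fusionRing A)
    (x : A) : 'End((complex R)^o) :=
  FPdim R F x *: \1%VF.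

(* Main.v *)
Require Import Defs.
From HB Require Import structures.
From mathcomp Require Import all_boot all_order all_algebra.
From mathcomp Require Import classical_sets reals.

(** The coefficient of the unit is a symmetric trace [tau] for which the basis
    and its dual are dual bases.  Cyclicity of [tau] forces
    [x rho = rho x = d(x) rho] for [x] in [S], with [d : S -> Z] a character,
    and [rho ^ 2 = kappa rho + E] with [E] in [S] and [x E = d(x) E].  The
    linear extension of [phi] killing [rho] is multiplicative iff [phi E = 0].
    Otherwise the image of [phi E] is a nonzero subrepresentation on which [S]
    acts through [d], so [phi] is [d] itself by irreducibility.  Finally
    [d = FPdim], because [E] provides a left eigenvector of every fusion matrix
    with eigenvalue [d(b_i)], and pairing with the positive right eigenvector
    [(d(b_k))_k] bounds all other eigenvalues by it. *)

Set Implicit Arguments.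
Unset Strict Implicit.
Unset Printing Implicit Defensive.

Import Order.TTheory GRing.Theory Num.Theory.

Local Open Scope ring_scope.

(** * Additive maps, and maximal eigenvalues of nonnegative matrices *)

Lemma morph_addMz (U V : zmodType) (f : U -> V) :
  {morph f : x y / x + y} -> forall x n, f (x *~ n) = f x *~ n.
Proof.
move=> fD x n.
have f0 : f 0 = 0 by apply: (addrI (f 0)); rewrite -fD !addr0.
have fN y : f (- y) = - f y by apply/eqP; rewrite -addr_eq0 -fD addNr f0.
have fMn m : f (x *+ m) = f x *+ m.
  by elim: m => [|m IHm]; rewrite ?mulr0n // !mulrS fD IHm.
by case: n => n; rewrite ?NegzE ?mulrNz ?fN -!pmulrn fMn.
Qed.

Lemma morph_add_sum (U V : zmodType) (f : U -> V) :
  {morph f : x y / x + y} ->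
  forall (I : Type) (r : seq I) (Q : pred I) (g : I -> U),
  f (\sum_(i <- r | Q i) g i) = \sum_(i <- r | Q i) f (g i).
Proof.
by move=> fD I r Q g; apply: big_morph => //; exact: (morph_addMz fD 0 0).
Qed.

(* Pairing [v *m M = b *: v] with [u] gives [`|b| * w <= a * w] for the positive
   number [w = \sum_k `|v_k| * u_k]. *)
Lemma max_real_eigenvalue_pos (R : realType) n (M : 'M[R]_n) (u : 'cV[R]_n) a :
  (forall j k, 0 <= M j k) -> (forall k, 0 < u k ord0) ->
  M *m u = a *: u -> eigenvalue M a -> max_real_eigenvalue M = a.
Proof.
move=> M_ge0 u_gt0 Mu eig_a.
have ub_a : ubound [set b : R | eigenvalue M b]%classic a.
  move=> b /eigenvalueP [v vM v_neq0]; apply: le_trans (ler_norm b) _.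
  pose w := \sum_k `|v ord0 k| * u k ord0.
  have w_gt0 : 0 < w.
    have [k vk_neq0] : exists k, v ord0 k != 0.
      apply/existsP; apply: contraNT v_neq0 => /existsPn v0.
      by apply/eqP/rowP => k; rewrite mxE; apply/eqP/negPn/v0.
    rewrite /w (bigD1 k) //= ltr_pwDl ?mulr_gt0 ?normr_gt0 //.
    by apply: sumr_ge0 => j _; rewrite mulr_ge0 // ltW.
  rewrite -(ler_pM2r w_gt0) /w !mulr_sumr.
  have -> : \sum_j a * (`|v ord0 j| * u j ord0) =
            \sum_k (\sum_j `|v ord0 j| * M j k) * u k ord0.
    under [RHS]eq_bigr do rewrite mulr_suml.
    rewrite exchange_big; apply: eq_bigr => j _ /=.
    have := congr1 (fun B : 'cV[R]_n => B j ord0) Mu; rewrite !mxE => Muj.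
    rewrite mulrCA -Muj mulr_sumr.
    by apply: eq_bigr => k _; rewrite mulrA.
  apply: ler_sum => k _; rewrite mulrA ler_pM2r // -normrM.
  have := congr1 (fun B : 'rV[R]_n => B ord0 k) vM; rewrite !mxE => <-.
  apply: le_trans (ler_norm_sum _ _ _) _.
  by apply: ler_sum => j _; rewrite normrM (ger0_norm (M_ge0 j k)).
apply/eqP; rewrite eq_le /max_real_eigenvalue; apply/andP; split.
  by apply: ge_sup => //; exists a.
by apply: ub_le_sup => //; exists a.
Qed.

(** * Coordinates and the trace form of a fusion ring *)

Section FusionRingTheory.

Variables (A : nzRingType) (F : fusionRing A).

Lemma basis_coordD k : {morph (fun x => basis_coord F x k) : x y / x + y}.
Proof.
move=> x y /=; rewrite -[in LHS](sum_coord F x) -[in LHS](sum_coord F y).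
rewrite -big_split /=; under eq_bigr do rewrite -mulrzDr.
exact: (coord_sum (f := F) (fun i => basis_coord F x i + basis_coord F y i)).
Qed.

Lemma basis_coordMz x n k : basis_coord F (x *~ n) k = basis_coord F x k *~ n.
Proof. exact: (morph_addMz (@basis_coordD k)). Qed.

Lemma basis_coord_sum (I : Type) (r : seq I) (Q : pred I) (f : I -> A) k :
  basis_coord F (\sum_(i <- r | Q i) f i) k =
  \sum_(i <- r | Q i) basis_coord F (f i) k.
Proof. exact: (morph_add_sum (@basis_coordD k)). Qed.

Lemma basis_coord_basis i k : basis_coord F (basis F i) k = (i == k)%:Z.
Proof.
rewrite eq_sym -(coord_sum (f := F) (fun k => (k == i)%:Z)) (bigD1 i) //= eqxx.
by rewrite mulr1z big1 ?addr0 // => j /negPf ->; rewrite mulr0z.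
Qed.

Lemma basis_inj : injective (basis F).
Proof.
move=> i j eq_ij; have := basis_coord_basis j i.
by rewrite -eq_ij basis_coord_basis eqxx; case: eqVneq.
Qed.

Lemma basis_coord_inj x y : basis_coord F x =1 basis_coord F y -> x = y.
Proof.
move=> eq_xy; rewrite -(sum_coord F x) -(sum_coord F y).
by apply: eq_bigr => i _; rewrite eq_xy.
Qed.

(** Among the products [b_i b_{k*}] only the one with [i = k] contains the unit. Coordinates thus
    become traces, whose factors can be permuted cyclically. *)
Lemma basis_coord_trace x k :
  basis_coord F x k = basis_coord F (x * basis F (dual F k)) ord0.
Proof.
rewrite -[in RHS](sum_coord F x) mulr_suml basis_coord_sum (bigD1 k) //=.
rewrite mulrzAl basis_coordMz str_const_unit dual_involutive eqxx.
rewrite big1 => [|i /negPf nik]; first by rewrite addr0 mulrzz mul1r.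
by rewrite mulrzAl basis_coordMz str_const_unit dual_involutive nik mul0rz.
Qed.

Lemma trace_mulC x y : basis_coord F (x * y) ord0 = basis_coord F (y * x) ord0.
Proof.
have basisC i j : basis_coord F (basis F i * basis F j) ord0 =
                  basis_coord F (basis F j * basis F i) ord0.
  by rewrite !str_const_unit -(inv_eq (dual_involutive (f := F))) eq_sym.
rewrite -(sum_coord F x) -(sum_coord F y) !mulr_suml !basis_coord_sum.
under eq_bigr do rewrite mulr_sumr basis_coord_sum.
under [RHS]eq_bigr do rewrite mulr_sumr basis_coord_sum.
rewrite exchange_big; apply: eq_bigr => j _; apply: eq_bigr => i _ /=.
by rewrite !(mulrzAl, mulrzAr, basis_coordMz) basisC mulrzAC.
Qed.

End FusionRingTheory.

(** * Near-integral rings: indices, duality and the action of [S] on [rho] *)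

Section NearIntegral.

Variables (A : nzRingType) (F : fusionRing A).
Variables (P : {pred A}) (S : subNzRingType P) (G : fusionRing S).
Variables (rho : 'I_(rank F)) (kappa : nat).

(** By counting: an injection of the indices of [S] into the complement of [rho], a set of the same
    size, is onto. *)
Lemma near_integral_index : near_integral F G rho kappa ->
  exists iota : 'I_(rank G) -> 'I_(rank F),
    [/\ forall j, val (basis G j) = basis F (iota j),
        injective iota,
        forall j, iota j != rho &
        forall i, i != rho -> exists j, i = iota j].
Proof.
case=> subG rankG rhoG _; have [iota iotaE] := fin_all_exists subG.
have iota_inj : injective iota.
  move=> j k eq_jk; apply: (@basis_inj _ G); apply: val_inj.
  by rewrite !iotaE eq_jk.
have iota_rho j : iota j != rho.
  by apply/eqP => eq_j; case: (rhoG j); rewrite iotaE eq_j.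
exists iota; split=> // i i_rho.
have: [set iota j | j in 'I_(rank G)] == [set~ rho].
  have rankF : ((rank F).-1 <= rank G)%N by rewrite -rankG addn1.
  rewrite eqEcard cardsC1 card_imset // !card_ord rankF andbT.
  by apply/fintype.subsetP => _ /imsetP [j _ ->]; rewrite !inE.
move/eqP/setP/(_ i); rewrite !inE i_rho => /imsetP [j _ ->].
by exists j.
Qed.

Variable iota : 'I_(rank G) -> 'I_(rank F).
Hypothesis iotaE : forall j, val (basis G j) = basis F (iota j).
Hypothesis iota_inj : injective iota.
Hypothesis iota_rho : forall j, iota j != rho.
Hypothesis iota_surj : forall i, i != rho -> exists j, i = iota j.

Local Notation r := (basis F rho).

Lemma index0 : iota ord0 = ord0.
Proof.
by apply: (@basis_inj _ F); rewrite -iotaE !basis_unit rmorph1.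
Qed.

Lemma val_sum_coord (x : S) :
  val x = \sum_j basis F (iota j) *~ basis_coord G x j.
Proof.
rewrite -[in LHS](sum_coord G x) raddf_sum /=.
by apply: eq_bigr => j _; rewrite raddfMz -iotaE.
Qed.

Lemma coord_val_index (x : S) j :
  basis_coord F (val x) (iota j) = basis_coord G x j.
Proof.
rewrite val_sum_coord basis_coord_sum (bigD1 j) //= basis_coordMz.
rewrite basis_coord_basis eqxx big1 => [|k nkj]; last first.
  rewrite basis_coordMz basis_coord_basis (inj_eq iota_inj) (negPf nkj).
  by rewrite mul0rz.
by rewrite addr0 mulrzz mul1r.
Qed.

Lemma coord_val_rho (x : S) : basis_coord F (val x) rho = 0.
Proof.
rewrite val_sum_coord basis_coord_sum big1 // => j _.
by rewrite basis_coordMz basis_coord_basis (negPf (iota_rho j)) mul0rz.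
Qed.

(** The dual of an index is the only one whose product with it contains the unit, and inside [S]
    that product has the same unit coefficient. *)
Lemma dual_index j : dual F (iota j) = iota (dual G j).
Proof.
have := str_const_unit (f := F) (iota (dual G j)) (iota j).
rewrite -!iotaE -rmorphM -index0 coord_val_index str_const_unit eqxx.
by case: eqVneq.
Qed.

Lemma dual_rho : dual F rho = rho.
Proof.
apply/eqP/negPn/negP => /iota_surj [j dual_j].
have := iota_rho (dual G j); rewrite -dual_index -dual_j dual_involutive.
by rewrite eqxx.
Qed.

(** The character [d]: the scalar by which [x] will be seen to act on [rho]. *)
Definition fchar (x : S) : int := basis_coord F (val x * r) rho.

Lemma fcharD : {morph fchar : x y / x + y}.
Proof. by move=> x y; rewrite /fchar raddfD mulrDl basis_coordD. Qed.

Lemma eq_index_coord x y :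
  basis_coord F x rho = basis_coord F y rho ->
  (forall j, basis_coord F x (iota j) = basis_coord F y (iota j)) -> x = y.
Proof.
move=> eq_rho eq_iota; apply: (basis_coord_inj (F := F)) => i.
by have [-> | /iota_surj [j ->]] := eqVneq i rho.
Qed.

Lemma coord_rhoMz n : basis_coord F (r *~ n) rho = n.
Proof. by rewrite basis_coordMz basis_coord_basis eqxx mulrzz mul1r. Qed.

Lemma coord_rhoMz_index n j : basis_coord F (r *~ n) (iota j) = 0.
Proof.
by rewrite basis_coordMz basis_coord_basis eq_sym (negPf (iota_rho j)) mul0rz.
Qed.

(** The coefficient of [b_j] in [x rho] is the trace of [b_{j*} x rho]. As [rho] is self-dual, this
    is the [rho]-coordinate of [b_{j*} x], which vanishes in [S]. *)
Lemma val_mul_rho (x : S) : val x * r = r *~ fchar x.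
Proof.
apply: eq_index_coord => [|j]; first by rewrite coord_rhoMz.
rewrite coord_rhoMz_index basis_coord_trace trace_mulC mulrA dual_index.
by rewrite -iotaE -rmorphM -{1}dual_rho -basis_coord_trace coord_val_rho.
Qed.

Lemma rho_mul_val (x : S) : r * val x = r *~ fchar x.
Proof.
apply: eq_index_coord => [|j].
  (* The left and right scalars agree because [rho x rho] and [x rho rho] have the same trace. *)
  rewrite coord_rhoMz /fchar [LHS]basis_coord_trace [RHS]basis_coord_trace.
  by rewrite dual_rho -mulrA trace_mulC.
rewrite coord_rhoMz_index basis_coord_trace dual_index -iotaE.
rewrite -mulrA trace_mulC -rmorphM -{1}dual_rho -basis_coord_trace.
by rewrite coord_val_rho.
Qed.

Lemma fchar1 : fchar 1 = 1.
Proof. by rewrite /fchar rmorph1 mul1r basis_coord_basis eqxx. Qed.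

Lemma fcharM x y : fchar (x * y) = fchar x * fchar y.
Proof.
rewrite -[LHS](coord_rhoMz) -val_mul_rho rmorphM -mulrA val_mul_rho mulrzAr.
by rewrite val_mul_rho -mulrzA coord_rhoMz.
Qed.

Lemma fchar_coord x : fchar x = \sum_i fchar (basis G i) * basis_coord G x i.
Proof.
rewrite -[in LHS](sum_coord G x) (morph_add_sum fcharD).
by apply: eq_bigr => i _; rewrite (morph_addMz fcharD) mulrzz.
Qed.

Lemma fchar_basis_ge0 i : 0 <= fchar (basis G i).
Proof. by rewrite /fchar iotaE str_const_ge0. Qed.

(** The product [b_i b_{i*}] contains the unit once and has nonnegative coefficients, so
    [d(b_i) d(b_{i*}) >= 1]. *)
Lemma fchar_basis_gt0 i : 0 < fchar (basis G i).
Proof.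
rewrite lt_neqAle fchar_basis_ge0 andbT eq_sym; apply/eqP => fchar_i0.
have := fcharM (basis G i) (basis G (dual G i)).
rewrite fchar_i0 mul0r fchar_coord (bigD1 ord0) //= str_const_unit.
rewrite dual_involutive eqxx basis_unit fchar1 mul1r; apply/eqP.
rewrite gt_eqF // ltr_pwDl //; apply: sumr_ge0 => k _.
by rewrite mulr_ge0 ?fchar_basis_ge0 ?str_const_ge0.
Qed.

(** * The projection of [A] onto [S] along [rho] *)

Definition sproj (a : A) : S := \sum_j basis G j *~ basis_coord F a (iota j).

Lemma sprojD : {morph sproj : a b / a + b}.
Proof.
move=> a b; rewrite /sproj -big_split; apply: eq_bigr => j _ /=.
by rewrite basis_coordD mulrzDr.
Qed.

Lemma coord_sproj a j : basis_coord G (sproj a) j = basis_coord F a (iota j).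
Proof. exact: (coord_sum (f := G) (fun k => basis_coord F a (iota k))). Qed.

Lemma sproj_val x : sproj (val x) = x.
Proof.
by apply: (basis_coord_inj (F := G)) => j; rewrite coord_sproj coord_val_index.
Qed.

Lemma sproj_rhoMz n : sproj (r *~ n) = 0.
Proof. by rewrite /sproj big1 // => j _; rewrite coord_rhoMz_index mulr0z. Qed.

Lemma sproj_rho : sproj r = 0.
Proof. exact: (sproj_rhoMz 1). Qed.

Lemma sprojK a : val (sproj a) + r *~ basis_coord F a rho = a.
Proof.
apply: eq_index_coord => [|j]; rewrite basis_coordD.
  by rewrite coord_val_rho coord_rhoMz add0r.
by rewrite coord_val_index coord_sproj coord_rhoMz_index addr0.
Qed.

(** Mixed products of [S] with [rho] are multiples of [rho] and project to zero, so the [S]-part of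
    [rho^2] is the only obstruction to multiplicativity. *)
Lemma sprojM a b : sproj (a * b) =
  sproj a * sproj b +
  sproj (r * r) *~ (basis_coord F a rho * basis_coord F b rho).
Proof.
rewrite -[in LHS](sprojK a) -[in LHS](sprojK b) mulrDl !mulrDr !sprojD.
rewrite -rmorphM sproj_val !mulrzAr !mulrzAl val_mul_rho rho_mul_val.
rewrite -!mulrzA !sproj_rhoMz addr0 add0r.
by rewrite (morph_addMz sprojD).
Qed.

(** Project [x (rho rho) = (x rho) rho]; the correction term vanishes since [x] has no
    [rho]-coordinate. *)
Lemma mul_sproj_rho2 x : x * sproj (r * r) = sproj (r * r) *~ fchar x.
Proof.
have := sprojM (val x) (r * r).
rewrite mulrA val_mul_rho mulrzAl (morph_addMz sprojD) sproj_val => ->.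
by rewrite coord_val_rho mul0r mulr0z addr0.
Qed.

(** * Identification of [d] with [FPdim] *)

Lemma max_real_eigenvalue_fusion (R : realType) (i : 'I_(rank G)) :
  max_real_eigenvalue (fusion_matrix R i) = (fchar (basis G i))%:~R.
Proof.
apply: (@max_real_eigenvalue_pos _ _ _ (\col_k (fchar (basis G k))%:~R)).
- by move=> j k; rewrite mxE ler0z str_const_ge0.
- by move=> k; rewrite mxE ltr0z fchar_basis_gt0.
- apply/colP => j; rewrite !mxE -intrM -fcharM fchar_coord raddf_sum /=.
  by apply: eq_bigr => k _; rewrite !mxE -intrM mulrC.
apply/eigenvalueP.
exists (\row_k (basis_coord G (sproj (r * r)) k)%:~R).
  apply/rowP => k; rewrite !mxE -intrM.
  have -> : fchar (basis G i) * basis_coord G (sproj (r * r)) k =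
            basis_coord G (basis G i * sproj (r * r)) k.
    by rewrite mul_sproj_rho2 basis_coordMz mulrzz mulrC.
  rewrite -[in RHS](sum_coord G (sproj (r * r))) mulr_sumr basis_coord_sum.
  rewrite raddf_sum /=; apply: eq_bigr => j _.
  by rewrite !mxE -intrM mulrzAr basis_coordMz mulrzz mulrC.
(* The row is nonzero at the unit: [rho] being self-dual, [rho^2] contains it with coefficient 1. *)
apply/eqP => /rowP /(_ ord0); rewrite !mxE coord_sproj index0 str_const_unit.
by rewrite dual_rho eqxx; apply/eqP; rewrite oner_eq0.
Qed.

Lemma FPdim_fchar (R : realType) x : FPdim R G x = (fchar x)%:~R.
Proof.
rewrite fchar_coord raddf_sum /=; apply: eq_bigr => i _.
by rewrite max_real_eigenvalue_fusion rmorph_int intrM mulrzr.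
Qed.

End NearIntegral.

(* By irreducibility every line of [V] is everything, so [dim V = 1]. *)
Lemma scalar_rep_iso (K : fieldType) (A : nzRingType) (V : vectType K)
    (phi : A -> 'End(V)) (chi : A -> K) :
  irreducible_rep phi -> (forall x, phi x = chi x *: \1%VF) ->
  rep_iso phi (fun x => chi x *: \1%VF : 'End(K^o)).
Proof.
case=> _ dimV irrV phiE.
have [v v_neq0] : exists v : V, v != 0.
  exists (vpick fullv); rewrite vpick0; apply: contraNneq dimV => ->.
  by rewrite dimv0.
have full_v : <[v]>%VS = fullv.
  case: (irrV <[v]>%VS) => [x|v0|//].
    apply/subvP => _ /memv_imgP [u u_v ->].
    by rewrite phiE lfunE /= id_lfunE memvZ.
  by move/eqP: v_neq0; case; apply/eqP; rewrite -memv0 -v0 memv_line.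
have free_v : free [tuple v] by rewrite seq1_free.
pose f : 'Hom(V, K^o) := linfun (coord [tuple v] ord0 : V -> K^o).
have fv c : f (c *: v) = c.
  rewrite linearZ /= lfunE /=.
  by have := coord_free ord0 ord0 free_v; rewrite /= => ->; exact: mulr1.
exists f.
  exists (fun c : K^o => c *: v) => // u.
  have /vlineP [c ->] : u \in <[v]>%VS by rewrite full_v; exact: memvf.
  by rewrite fv.
move=> x; apply/lfunP => u.
by rewrite phiE !comp_lfunE !scale_lfunE !id_lfunE linearZ.
Qed.

(** * Extension of representations from [S] to [A] by zero on [rho] *)

Theorem proposition3p4 (R : realType)
    (A : nzRingType) (F : fusionRing A)
    (P : {pred A}) (S : subNzRingType P) (G : fusionRing S)
    (rho : 'I_(rank F)) (kappa : nat)
    (hA : near_integral F G rho kappa)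
    (V : vectType (complex R)) (phi : S -> 'End(V))
    (hphi : irreducible_rep phi)
    (hFP : ~ rep_iso phi (FPdim_rep R G)) :
  exists phi' : A -> 'End(V),
    [/\ irreducible_rep phi',
        forall x : S, phi' (val x) = phi x,
        phi' (basis F rho) = 0,
        (* uniqueness among homomorphisms to End(V) *)
        (forall psi : A -> 'End(V), irreducible_rep psi ->
          (forall x : S, psi (val x) = phi x) ->
          psi (basis F rho) = 0 -> forall x : A, psi x = phi' x) &
        (* uniqueness among isomorphism classes *)
        (forall (W : vectType (complex R)) (psi : A -> 'End(W)),
          irreducible_rep psi ->
          rep_iso (fun x : S => psi (val x)) phi ->
          psi (basis F rho) = 0 -> rep_iso psi phi')].
Proof.
have [iota [iotaE iota_inj iota_rho iota_surj]] := near_integral_index hA.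
have [[phi1 phiD phiM] dimV irrV] := hphi.
pose p := sproj iota; pose E : S := p (basis F rho * basis F rho).
have p_val (x : S) : p (val x) = x by exact: sproj_val.
have pK a : a = val (p a) + basis F rho *~ basis_coord F a rho.
  by rewrite /p sprojK.
have phiE0 : phi E = 0.
  apply/eqP/negPn/negP => phiE_neq0; apply: hFP.
  have phi_mulE x : (phi x \o phi E)%VF = (fchar rho x)%:~R *: phi E.
    by rewrite -phiM (mul_sproj_rho2 iotaE) // (morph_addMz phiD) scaler_int.
  have limgE : limg (phi E) = fullv.
    case: (irrV (limg (phi E))) => [x|limg0|//].
      by rewrite -limg_comp phi_mulE; apply/subvP => _ /memv_imgP [u _ ->];
        rewrite scale_lfunE memvZ // memv_img ?memvf.
    case/eqP: phiE_neq0; apply/lfunP => u; apply/eqP.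
    by rewrite lfunE /= -memv0 -limg0 memv_img ?memvf.
  have phi_scalar x : phi x = FPdim R G x *: \1%VF.
    rewrite (FPdim_fchar iotaE iota_inj iota_rho) //; apply/lfunP => w.
    have /memv_imgP [u _ ->] : w \in limg (phi E) by rewrite limgE; exact: memvf.
    by rewrite -comp_lfunE phi_mulE !scale_lfunE id_lfunE.
  exact: scalar_rep_iso.
(* A representation killing [rho] factors through [p], so it is determined by its restriction to
   [S]; both uniqueness claims rest on this. *)
have extE (W : vectType (complex R)) (psi : A -> 'End(W)) :
    representation psi -> psi (basis F rho) = 0 ->
    forall a, psi a = psi (val (p a)).
  move=> [_ psiD _] psi_rho a.
  by rewrite [in LHS](pK a) psiD (morph_addMz psiD) psi_rho mul0rz addr0.
exists (phi \o p); split=> [||| psi [psi_rep _ _] psi_val psi_rho a|].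
- split=> //.
    split=> [|a b|a b] /=.
    + by rewrite -(rmorph1 (val : S -> A)) p_val.
    + by rewrite /p sprojD phiD.
    + rewrite /p (sprojM iotaE iota_inj iota_rho) // phiD (morph_addMz phiD).
      by rewrite phiE0 mul0rz addr0.
  (* Every operator of [phi] occurs in the extension, so a subspace stable under the extension is
     stable under [phi]. *)
  by move=> U stabU; apply: irrV => x; have := stabU (val x); rewrite /= p_val.
- by move=> x /=; rewrite p_val.
- by rewrite /= /p sproj_rho //; have := morph_addMz phiD 0 0; rewrite !mulr0z.
- by rewrite (extE _ _ psi_rep) // psi_val.
(* The isomorphism [f] over [S] already intertwines the actions of [A]. *)
move=> W psi [psi_rep _ _] [f f_bij f_morph] psi_rho; exists f => // a.
by rewrite (extE _ _ psi_rep) // f_morph.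
Qed.
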